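(* Let $X$ and $Y$ be topological spaces, $X$ locally compact, and $f\colon X\to Y$ a continuous map. Let $x$ be an equilibrium point of a continuous flow $\phi\colon X\times\mathbb R\to X$, $\phi_t(x')=\phi(x',t)$, on $X$ which preserves $f$, i.e. $f(\phi_t(x'))=f(x')$ for all $x'\in X$ and $t\in\mathbb R$, and let $y=f(x)$. Then $x$ is stable if it is an isolated point in $f^{-1}(T_2(y))$.
   Context: For a topological space $Y$ and $y\in Y$, $T_2(y)$ is the set of all $y'\in Y$ such that $U\cap U'\neq\emptyset$ for all neighbourhoods $U$ of $y$ and $U'$ of $y'$ in $Y$. ''$x$ is an isolated point of $f^{-1}(T_2(y))$'' means that there is a neighbourhood $U$ of $x$ in $X$ with $f^{-1}(T_2(y))\cap U=\{x\}$. An equilibrium point $x$ (so $\phi_t(x)=x$ for all $t$) is stable if for every open neighbourhood $U$ of $x$ in $X$ there is a neighbourhood $V$ of $x$ such that $x'\in V$ implies $\phi_t(x')\in U$ for all $t$. A space is locally compact if each of its points has a neighbourhood base consisting of compact sets. The spaces $X$ and $Y$ are not assumed to be Hausdorff. *)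

(* Defs.v *)
From HB Require Import structures.
From mathcomp Require Import all_boot all_order all_algebra.
From mathcomp Require Import all_classical all_reals all_analysis.

Set Implicit Arguments.
Unset Strict Implicit.
Unset Printing Implicit Defensive.

Import Order.TTheory GRing.Theory Num.Theory.
Import numFieldNormedType.Exports.

Local Open Scope classical_set_scope.
Local Open Scope ring_scope.

Definition T2 (Y : topologicalType) (y : Y) : set Y :=
  [set y' | forall U U' : set Y, nbhs y U -> nbhs y' U' -> U `&` U' !=set0].

(* The library's [locally_compact] asks for one closed compact neighbourhood of
   each point; without the Hausdorff assumption this is a different notion. *)
Definition base_locally_compact (X : topologicalType) : Prop :=
  forall (x : X) (U : set X), nbhs x U ->
    exists K : set X, [/\ nbhs x K, compact K & K `<=` U].

Definition continuous_flow (R : realType) (X : topologicalType)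
    (phi : X * R -> X) : Prop :=
  [/\ continuous phi,
      forall x, phi (x, 0) = x
    & forall x s t, phi (phi (x, s), t) = phi (x, s + t)].

Definition equilibrium (R : realType) (X : topologicalType)
    (phi : X * R -> X) (x : X) : Prop :=
  forall t, phi (x, t) = x.

Definition preserves (R : realType) (X Y : topologicalType)
    (phi : X * R -> X) (f : X -> Y) : Prop :=
  forall x t, f (phi (x, t)) = f x.

(* Time ranges over all of R, not only over t >= 0. *)
Definition stable (R : realType) (X : topologicalType)
    (phi : X * R -> X) (x : X) : Prop :=
  forall U : set X, open_nbhs x U ->
    exists2 V : set X, nbhs x V & forall x', V x' -> forall t, U (phi (x', t)).

(* Main.v *)
Require Import Defs.
From HB Require Import structures.
From mathcomp Require Import all_boot all_order all_algebra.
From mathcomp Require Import all_classical all_reals all_analysis.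

Set Implicit Arguments.
Unset Strict Implicit.
Unset Printing Implicit Defensive.

Import Order.TTheory GRing.Theory Num.Theory.
Import numFieldNormedType.Exports.

Local Open Scope classical_set_scope.
Local Open Scope ring_scope.

(** Choose a compact neighbourhood K of x inside the prescribed open set U and
    inside a neighbourhood in which x is the only point of f^-1 (T2 y).  By
    continuity of the flow at (x, 0) there are a neighbourhood W of x and a
    time e > 0 such that, within time e, points of W do not leave K.  If x' is
    close enough to x, the fibre of f through x' meets K only inside W: a point
    z of K outside W has f z outside T2 y, so neighbourhoods of z and x are
    mapped by f to disjoint sets, and compactness of K makes the neighbourhood
    of x uniform in z ([near_fibre_trap]).  The orbit of x' lies in this fibre,
    so as long as it is in W it stays in K for a time e, hence is again in W;
    advancing by steps shorter than e it never leaves W ([orbit_trap]).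

    The usual argument, that a leaving orbit crosses the boundary of K, breaks
    down here: K need not be closed when X is not Hausdorff, so an orbit may
    leave the interior of K without ever meeting K minus its interior.  The
    step length e, which exists because x is an equilibrium, replaces it. *)

(** Non-membership in T2 y separates f z from y by disjoint neighbourhoods;
    pulled back along f they separate the fibres near z from those near x.
    The covering form of compactness then makes this uniform over K. *)
Lemma near_fibre_trap (X Y : topologicalType) (f : X -> Y) (x : X)
    (K W : set X) :
  continuous f -> compact K -> nbhs x W ->
  K `&` f @^-1` T2 (f x) `<=` [set x] ->
  \forall x' \near x, K `&` f @^-1` [set f x'] `<=` W.
Proof.
move=> cf cK; rewrite nbhsE => -[W' [oW' W'x] W'W] Kx.
have : \forall x' \near x, K `<=` fun z => f z = f x' -> W z.
  apply: (compact_near_coveringP K).1 => // z Kz.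
  have [T2z|nT2z] := pselect (T2 (f x) (f z)).
    have -> : z = x by apply: Kx.
    by exists (W', setT); [split; [exact: open_nbhs_nbhs|exact: filterT]|
      move=> [z' x'] [/= W'z' _] _; exact: W'W].
  have [A [B [Ax Bz AB0]]] : exists A B : set Y,
      [/\ nbhs (f x) A, nbhs (f z) B & A `&` B = set0].
    apply: contrapT => noAB; apply: nT2z => A B Ax Bz.
    by apply/set0P/negP => /eqP AB0; apply: noAB; exists A, B.
  exists (f @^-1` B, f @^-1` A); first by split; apply: cf.
  move=> [z' x'] [/= Bz' Ax'] fz'x'; exfalso.
  have : (A `&` B) (f x') by split => //; rewrite -fz'x'.
  by rewrite AB0.
by apply: filterS => x' Kx' z [Kz fz]; exact: Kx'.
Qed.

(** Any time t is a sum of n equal steps of length less than e, and along such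
    steps membership in W propagates: the next position is in K, by the choice
    of e, and on the orbit, hence in W. *)
Lemma orbit_trap (R : realType) (X : topologicalType) (phi : X * R -> X)
    (x' : X) (K W : set X) (e : R) :
  continuous_flow phi -> 0 < e ->
  (forall w s, W w -> `|s| < e -> K (phi (w, s))) ->
  (forall s, K (phi (x', s)) -> W (phi (x', s))) ->
  W x' -> forall t, W (phi (x', t)).
Proof.
move=> [_ phi0 phiD] e0 WK KW Wx' t.
pose n := (Num.truncn (`|t| / e)).+1.
have n0 : 0 < n%:R :> R by rewrite ltr0n.
have step : `|t / n%:R| < e.
  rewrite normrM normfV (gtr0_norm n0) ltr_pdivrMr // mulrC -ltr_pdivrMr //.
  exact: truncnS_gt.
have steps k : W (phi (x', (t / n%:R) *+ k)).
  elim: k => [|k IH]; first by rewrite mulr0n phi0.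
  by rewrite mulrSr; apply: KW; rewrite -phiD; exact: WK.
by have := steps n; rewrite -mulr_natr divfK // gt_eqF.
Qed.

Theorem corollary2p4 (R : realType) (X Y : topologicalType)
    (hX : base_locally_compact X)
    (f : X -> Y) (hf : continuous f)
    (phi : X * R -> X) (hphi : continuous_flow phi)
    (hpres : preserves phi f)
    (x : X) (hx : equilibrium phi x)
    (y : Y) (hy : y = f x)
    (hiso : isolated (f @^-1` T2 y) x) :
  stable phi x.
Proof.
move=> U /open_nbhs_nbhs Ux; rewrite {y}hy in hiso.
have [N Nx NE] : exists2 N, nbhs x N & N `&` f @^-1` T2 (f x) = [set x].
  by case: hiso => _ [N ? ?]; exists N.
have [K [Kx cK KUN]] := hX x (U `&` N) (filterI Ux Nx).
have [[W I] /= [Wx I0] WIK] : nbhs (x, 0 : R) (phi @^-1` K).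
  by case: hphi => cphi _ _; apply: cphi; rewrite hx.
have /nbhs_ballP[e /= e0 eI] := I0.
have KT2 : K `&` f @^-1` T2 (f x) `<=` [set x].
  by rewrite -NE; apply: setSI => z /KUN[].
exists (W `&` [set x' | K `&` f @^-1` [set f x'] `<=` W]).
  by apply: filterI => //; exact: near_fibre_trap.
move=> x' [Wx' fib] t.
have WK w s : W w -> `|s| < e -> K (phi (w, s)).
  move=> Ww se; apply: (WIK (w, s)); split => //=.
  by apply: eI; rewrite /ball /= sub0r normrN.
have KW s : K (phi (x', s)) -> W (phi (x', s)).
  by move=> Ks; apply: fib; split => //=; exact: hpres.
have WU w : W w -> U w.
  case: hphi => _ phi0 _ Ww.
  by have := WK w 0 Ww; rewrite normr0 phi0 => /(_ e0) /KUN[].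
exact/WU/(orbit_trap hphi e0 WK KW).
Qed.
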